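(* Let $G$ be a weighted digraph whose weights are induced by indeterminates $\{w_i(G)\}_{i\in V(G)}$ (that is, $w_{uv}(G)=w_v(G)$ for each edge $uv\in E(G)$), and suppose that $d_u^+(G)>0$ for each $u\in V(G)$. Let $\varepsilon=\{Q_1,\ldots,Q_r\}$ be a biclique partition of $G$, and set $w(Q_i)=\sum_{u\in Q_i^{(2)}}w_u(G)$. Let $\Omega(\varepsilon)$ be the weighted biclique digraph of $\varepsilon$ defined in the context. (1) For any $u\in V(G)$, $$t_u(G)=\frac{w_u(G)\prod_{v\in V(G),\,v\neq u}d_v(G)}{\prod_{j=1}^r w(Q_j)}\sum_{i:\,u\in Q_i^{(2)}}t_{Q_i}(\Omega(\varepsilon)).$$ (2) For any $Q_i\in\varepsilon$, $$t_{Q_i}(\Omega(\varepsilon))=\frac{\prod_{j=1}^r w(Q_j)}{\prod_{u\in V(G)}d_u(G)}\sum_{u\in Q_i^{(1)}}t_u(G).$$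
   Context: A digraph $G$ has a finite vertex set $V(G)$ and an edge set $E(G)$ of ordered pairs; $ij\in E(G)$ means there is a directed edge from tail $i$ to head $j$. $d_u^+(G)$ denotes the outdegree of $u$. In a weighted digraph each edge $ij$ carries a weight $w_{ij}(G)$, and the weighted degree of $u$ is $d_u(G)=\sum_{uv\in E(G)}w_{uv}(G)$. Given indeterminates $\{w_i(G)\}_{i\in V(G)}$ on the vertices, the weights of $G$ are said to be induced by them if $w_{uv}(G)=w_v(G)$ for every edge $uv$ (the weight of an edge is the indeterminate of its head). The stated identities are identities of rational functions in these indeterminates. An oriented spanning tree of $G$ with root $u$ is a subtree containing all vertices of $G$ in which $u$ has outdegree $0$ and every other vertex has outdegree $1$ (all edges point towards the root). $\mathbb{T}_u(G)$ is the set of oriented spanning trees of $G$ with root $u$, and $t_u(G)=\sum_{T\in\mathbb{T}_u(G)}\prod_{e\in E(T)}w_e(G)$. A biclique is a bipartite digraph $Q$ whose vertices are partitioned into two (nonempty, disjoint) parts $Q^{(1)},Q^{(2)}$ with $E(Q)=\{ij:i\in Q^{(1)},j\in Q^{(2)}\}$. A biclique partition of $G$ is a set $\varepsilon=\{Q_1,\ldots,Q_r\}$ of bicliques in $G$ (subdigraphs of $G$) such that each edge of $G$ belongs to exactly one biclique of $\varepsilon$. $\Omega(\varepsilon)$ is the weighted digraph with vertex set $\{Q_1,\ldots,Q_r\}$ and edge set $\{Q_iQ_j:Q_i^{(2)}\cap Q_j^{(1)}\neq\emptyset\}$, where the edge $Q_iQ_j$ has weight $$w_{Q_iQ_j}(\Omega(\varepsilon))=w(Q_j)\sum_{u\in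 Q_i^{(2)}\cap Q_j^{(1)}}\frac{w_u(G)}{d_u(G)},\qquad w(Q_j)=\sum_{u\in Q_j^{(2)}}w_u(G).$$ *)

(* Defs.v *)
From HB Require Import structures.
From mathcomp Require Import all_boot all_order all_algebra.
From mathcomp Require Import mpoly.

Set Implicit Arguments.
Unset Strict Implicit.
Unset Printing Implicit Defensive.

Import GRing.Theory.
Local Open Scope ring_scope.

(* A digraph on the finite vertex type [V] is its edge relation [E : rel V],
   [E x y] meaning that there is an edge from the tail [x] to the head [y].
   Weights are total functions on pairs of vertices; only their values on
   edges are ever used. *)

Section Digraphs.
Variables (V : finType).
Implicit Types (E : rel V) (S : {set V * V}) (u : V).

Definition edge_set E : {set V * V} := [set e | E e.1 e.2].

Definition outdegree E u : nat := #|[set v | E u v]|.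

Definition wdegree (F : fieldType) E (w : V -> V -> F) u : F :=
  \sum_(v | E u v) w u v.

Definition underlying S : rel V :=
  [rel x y | ((x, y) \in S) || ((y, x) \in S)].

(* The underlying undirected multigraph of [S] on the whole of [V] is a tree.
   The second clause excludes its cycles of length 1 (loops) and 2 (pairs of
   opposite edges); the third one excludes the longer ones (a duplicate-free
   sequence has at most [#|V|] items). *)
Definition is_spanning_tree S : bool :=
  [&& [forall x, forall y, connect (underlying S) x y],
      [forall x, forall y, ((x, y) \in S) ==> ((y, x) \notin S)] &
      [forall n : 'I_#|V|.+1, forall c : n.-tuple V,
         (2 < n)%N ==> ~~ ucycleb (underlying S) c]].

Definition oriented_spanning_trees E u : {set {set V * V}} :=
  [set S : {set V * V} | [&& S \subset edge_set E, is_spanning_tree S,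
               outdegree (fun x y => (x, y) \in S) u == 0%N &
               [forall v, (v != u) ==>
                  (outdegree (fun x y => (x, y) \in S) v == 1%N)]]].

Definition tree_sum (F : fieldType) E (w : V -> V -> F) u : F :=
  \sum_(S in oriented_spanning_trees E u) \prod_(e in S) w e.1 e.2.

End Digraphs.

Definition induced_weight (V : finType) (F : fieldType) (w : V -> F) :
  V -> V -> F := fun _ v => w v.

(* A biclique is encoded by the pair of its parts; as both are nonempty, its
   vertex set [Q.1 :|: Q.2] and edge set are determined by this pair, and it
   is a subdigraph of [G] as soon as its edges are edges of [G]. *)

Section Bicliques.
Variables (V : finType).
Implicit Types (E : rel V) (Q : {set V} * {set V}).
Implicit Types (eps : {set {set V} * {set V}}).

Definition is_biclique Q : bool :=
  [&& Q.1 != set0, Q.2 != set0 & [disjoint Q.1 & Q.2]].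

Definition biclique_edges Q : {set V * V} := setX Q.1 Q.2.

Definition biclique_partition E eps : Prop :=
  (forall Q, Q \in eps -> is_biclique Q /\ biclique_edges Q \subset edge_set E)
  /\ (forall e, e \in edge_set E ->
        exists! Q, Q \in eps /\ e \in biclique_edges Q).

Definition biclique_weight (F : fieldType) (w : V -> F) Q : F :=
  \sum_(u in Q.2) w u.

Definition Omega_vertex eps : finType := {Q | Q \in eps}.

Definition Omega_edge eps : rel (Omega_vertex eps) :=
  fun P Q : Omega_vertex eps => (val P).2 :&: (val Q).1 != set0.

Definition Omega_weight (F : fieldType) E (w : V -> F) eps
    (P Q : Omega_vertex eps) : F :=
  biclique_weight w (val Q) *
  \sum_(u in (val P).2 :&: (val Q).1) w u / wdegree E (induced_weight w) u.

End Bicliques.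

(* The field of rational functions over [R] in indeterminates indexed by [V],
   and its indeterminates. *)
Definition ratfun (R : idomainType) (V : finType) : fieldType :=
  {fraction {mpoly R[#|V|]}}.

Definition indet (R : idomainType) (V : finType) (v : V) : ratfun R V :=
  tofrac ('X_(enum_rank v) : {mpoly R[#|V|]}).

(* Main.v *)
(* With [D] and [W] the diagonal matrices of the degrees [d_u] and of the weights
   [w(Q)], the biclique partition factors the adjacency matrix of [G] through
   [eps], so that the Laplacians are [D (1 - X Y)] for [G] and [(1 - Y X) W] for
   [Omega(eps)], with [X] and [Y] the degree-normalised tail incidence and the
   weighted head incidence matrices.  As [adj (1 - X Y) X = X adj (1 - Y X)], the
   two adjugates determine each other; by the matrix tree theorem their
   [(v, u)] entries are the tree sums rooted at [u], for every [v]. *)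
Require Import Defs.
From mathcomp Require Import all_boot all_order all_algebra.
From mathcomp Require Import perm fraction.
From mathcomp Require Import mpoly ring.

Set Implicit Arguments.
Unset Strict Implicit.
Unset Printing Implicit Defensive.

Import GRing.Theory.
Local Open Scope ring_scope.

(** * Adjugates of products over an integral domain *)

Section Adjugate.
Variable R : idomainType.

Lemma det_char_poly_mx_neq0 n (A : 'M[R]_n) : \det (char_poly_mx A) != 0.
Proof. exact/monic_neq0/char_poly_monic. Qed.

Lemma char_poly_mx_horner n (A : 'M[R]_n) (x : R) :
  map_mx (horner_eval x) (char_poly_mx A) = x%:M - A.
Proof.
by apply/matrixP=> i j; rewrite !mxE /horner_eval !hornerE hornerMn hornerX.
Qed.

(* Characteristic matrices have a nonzero determinant, so the identity holds by
   cancellation for ['X + A] and ['X + B]; then evaluate at [0]. *)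
Lemma adj_mulmx n (A B : 'M[R]_n) : \adj (A *m B) = \adj B *m \adj A.
Proof.
have reg (S : idomainType) (C D : 'M[S]_n) : \det C != 0 -> \det D != 0 ->
    \adj (C *m D) = \adj D *m \adj C.
  move=> C0 D0; have CD0 : \det (C *m D) != 0 by rewrite det_mulmx mulf_neq0.
  apply: (scalemx_inj CD0); rewrite -!mul_scalar_mx -mul_adj_mx.
  rewrite -[LHS]mulmxA -[RHS]mulmxA; congr (_ *m _).
  rewrite mul_mx_adj -mulmxA (mulmxA D) mul_mx_adj.
  by rewrite -scalar_mxC mulmxA mul_mx_adj -scalar_mxM det_mulmx.
have /(congr1 (map_mx (horner_eval (0 : R)))) :=
  reg _ _ _ (det_char_poly_mx_neq0 (- A)) (det_char_poly_mx_neq0 (- B)).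
rewrite map_mxM !map_mx_adj map_mxM !char_poly_mx_horner raddf0.
by rewrite !sub0r !opprK.
Qed.

(** Two right multiplications make the block matrix [M] block triangular: one leaves ['X - a b]; the
    other leaves ['X] and ['X - b a], at the cost of a factor ['X^n]. *)
Lemma char_poly_mulmxC m n (A : 'M[R]_(m, n)) (B : 'M[R]_(n, m)) :
  'X^n * char_poly (A *m B) = 'X^m * char_poly (B *m A).
Proof.
rewrite /char_poly /char_poly_mx !map_mxM /=.
set a := map_mx _ A; set b := map_mx _ B.
pose M := block_mx 'X%:M a b 1%:M.
have <- : \det M = \det ('X%:M - a *m b).
  transitivity (\det (M *m block_mx 1%:M 0 (- b) 1%:M)).
    by rewrite det_mulmx det_lblock !det1 !mulr1.
  rewrite mulmx_block !mulmx1 !mulmx0 !mul1mx !add0r subrr mulmxN.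
  by rewrite det_ublock det1 mulr1.
transitivity (\det (M *m block_mx 1%:M (- a) 0 'X%:M)).
  by rewrite det_mulmx det_ublock det1 mul1r det_scalar mulrC.
rewrite mulmx_block !mulmx1 !mulmx0 !mul1mx !addr0 mulmxN scalar_mxC addNr.
by rewrite det_lblock det_scalar mulmxN addrC.
Qed.

(* Same device, evaluating at [1]. *)
Lemma adj_mulmxC m n (A : 'M[R]_(m, n)) (B : 'M[R]_(n, m)) :
  \adj (1%:M - A *m B) *m A = A *m \adj (1%:M - B *m A).
Proof.
pose N := char_poly_mx (A *m B); pose N' := char_poly_mx (B *m A).
pose a := map_mx polyC A.
have Na : N *m a = a *m N'.
  rewrite /N /N' /char_poly_mx !map_mxM mulmxBl mulmxBr.
  by rewrite scalar_mxC mulmxA.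
(* The powers of ['X] make up for the different sizes of [N] and [N']; they become 1 at the
   evaluation point. *)
have E : 'X^n *: (\adj N *m a) = 'X^m *: (a *m \adj N').
  apply: (scalemx_inj (det_char_poly_mx_neq0 (A *m B))); rewrite !scalerA.
  rewrite [in LHS]mulrC ['X^n * _](char_poly_mulmxC A B) [in RHS]mulrC.
  rewrite -!scalerA; congr (_ *: _).
  rewrite scalemxAr -[_ *: a]mul_mx_scalar.
  rewrite -[(\det _)%:M](mul_mx_adj N').
  by rewrite (mulmxA a) -Na 2!mulmxA mul_adj_mx -mulmxA mul_scalar_mx.
have ev k : horner_eval (1 : R) 'X^k = 1.
  by rewrite /horner_eval hornerXn expr1n.
have /(congr1 (map_mx (horner_eval (1 : R)))) := E.
rewrite !map_mxZ !map_mxM !map_mx_adj !char_poly_mx_horner /= !ev !scale1r.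
suff -> : map_mx (horner_eval 1) a = A by [].
by apply/matrixP=> i j; rewrite !mxE /horner_eval hornerC.
Qed.
End Adjugate.

(** * Oriented spanning trees as parent maps *)

Lemma fconnect_step (V : finType) (f : V -> V) x u :
  x != u -> fconnect f x u = fconnect f (f x) u.
Proof.
move=> xu; apply/idP/idP; last exact/connect_trans/fconnect1.
case/connectP=> -[|z p] /=; first by move=> _ ux; rewrite ux eqxx in xu.
by case/andP=> /eqP-> fp u_last; apply/connectP; exists p.
Qed.

Section SpanningTrees.
Variables (V : finType) (u : V).
Implicit Types (f : {ffun V -> V}) (E : rel V) (S : {set V * V}).

(** Parent map of a tree rooted at [u]. Sending the root to itself makes the encoding unique;
    [map_edges] leaves this loop out. *)
Definition rooted_map f : bool :=
  (f u == u) && [forall v, fconnect f v u].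

Definition map_edges f : {set V * V} := [set (v, f v) | v in predC1 u].

Lemma mem_map_edges f x y : ((x, y) \in map_edges f) = (x != u) && (f x == y).
Proof.
apply/imsetP/andP => [[v vu [-> ->]] | [xu /eqP <-]]; first by rewrite eqxx.
by exists x.
Qed.

Lemma map_edges_inj : {in rooted_map &, injective map_edges}.
Proof.
move=> f g /andP[/eqP fu _] /andP[/eqP gu _] /setP fg; apply/ffunP=> v.
have [->|vu] := eqVneq v u; first by rewrite fu gu.
have := fg (v, f v); rewrite !mem_map_edges vu eqxx /=.
by move/esym/eqP.
Qed.

Lemma rooted_map_neq f v : rooted_map f -> v != u -> f v != v.
Proof.
move=> /andP[_ /forallP/(_ v) vu] v_u; apply: contraNneq v_u => fv.
by rewrite -(iter_findex vu) iter_fix.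
Qed.

(** The depth of a vertex is its least number of steps to [u]. *)
Lemma rooted_map_depth f : rooted_map f ->
  exists d : V -> nat, forall v, v != u -> (d (f v) < d v)%N.
Proof.
move=> /andP[_ /forallP reach].
have ex v : exists k, iter k f v == u.
  by exists (findex f v u); rewrite iter_findex.
exists (fun v => ex_minn (ex v)) => v v_u.
case: ex_minnP => k _ kmin; case: ex_minnP => -[|l]; first by rewrite (negPf v_u).
by rewrite iterSr => lu _; rewrite ltnS kmin.
Qed.

(* A vertex of maximal depth on a cycle has both its neighbours as parent. *)
Lemma parent_relation_acyclic (f : V -> V) (d : V -> nat) (e : rel V) c :
    (forall x y, e x y -> [/\ x != u & f x = y] \/ [/\ y != u & f y = x]) ->
    (forall v, v != u -> (d (f v) < d v)%N) ->
    (2 < size c)%N -> cycle e c -> uniq c -> False.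
Proof.
move=> eP dlt n_gt2 ce cu.
have [x0 x0c] : exists x, x \in c.
  by case: (c) n_gt2 => // x s _; exists x; rewrite mem_head.
have [x xc xmax] := arg_maxnP d x0c; have [k s cr] := rot_to xc.
have nbr y : y \in rot k c -> e x y \/ e y x -> f x = y.
  rewrite mem_rot => /xmax; rewrite /geq /= => dy exy.
  have [[] //|[yu fy]] : [/\ x != u & f x = y] \/ [/\ y != u & f y = x].
    by case: exy => /eP // [] ?; [right | left].
  by have := dlt y yu; rewrite fy ltnNge dy.
move: ce cu n_gt2; rewrite -(rot_cycle k) -(rot_uniq k) -(size_rot k).
move: nbr; rewrite {}cr; case: s => [|y] //.
elim/last_ind => // s z _ nbr /=.
rewrite rcons_path last_rcons => /andP[exy /andP[_ ezx]] /and3P[_ + _] _.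
have <- : f x = y by apply: nbr; [rewrite !inE eqxx orbT | left].
have <- : f x = z by apply: nbr; [rewrite !(inE, mem_rcons) eqxx !orbT | right].
by rewrite mem_rcons mem_head.
Qed.

(** Any two vertices are joined through [u]. Depth decreases from child to parent, which excludes
    loops and opposite edges as well as longer cycles. *)
Lemma map_edges_spanning_tree f : rooted_map f -> is_spanning_tree (map_edges f).
Proof.
move=> rf; have [d dlt] := rooted_map_depth rf.
have [/eqP fu /forallP reach] := andP rf.
pose e := underlying (map_edges f).
have esym x y : e x y = e y x by exact: orbC.
have eE x y : e x y = (x != u) && (f x == y) || (y != u) && (f y == x).
  by rewrite -!mem_map_edges.
have eP x y : e x y -> [/\ x != u & f x = y] \/ [/\ y != u & f y = x].
  by rewrite eE => /orP[]/andP[? /eqP]; [left | right].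
apply/and3P; split.
- have cu x : connect e x u.
    have := iter_findex (reach x); move: (findex _ _ _) => k.
    elim: k x => [|k IHk] x; first by move=> /= ->; exact: connect0.
    rewrite iterSr => /IHk; have [-> | xu] := eqVneq x u; first by [].
    by apply: connect_trans; apply: connect1; rewrite eE xu eqxx.
  apply/forallP=> x; apply/forallP=> y; apply: (connect_trans (cu x)).
  by rewrite (sym_connect_sym esym).
- apply/forallP=> x; apply/forallP=> y; apply/implyP; rewrite !mem_map_edges.
  move=> /andP[xu /eqP fx]; apply/negP=> /andP[yu /eqP fy].
  have := dlt y yu; rewrite fy ltnNge -{1}fx; apply/negP/negPn.
  exact/ltnW/dlt.
- apply/forallP=> n; apply/forallP=> c; apply/implyP=> n_gt2.
  apply/negP; case/andP; apply: (parent_relation_acyclic (d := d) eP dlt).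
  by rewrite size_tuple.
Qed.

(** Conversely to the previous lemma, the outdegree conditions let a tree define a map, each vertex
    other than [u] going to the head of its only outgoing edge; connectedness makes every vertex
    reach [u]. *)
Lemma oriented_spanning_treesE E :
  oriented_spanning_trees E u =
    map_edges @: [set f | rooted_map f & [forall (v | v != u), E v (f v)]].
Proof.
apply/setP=> S; apply/idP/imsetP => [|[f]]; rewrite inE; last first.
  case/andP=> rf /forall_inP Ef ->; rewrite inE map_edges_spanning_tree //=.
  apply/and3P; split.
  - apply/subsetP=> _ /imsetP[v vu ->]; rewrite inE /=; exact: Ef.
  - rewrite cards_eq0; apply/eqP/setP=> y.
    by rewrite !inE mem_map_edges eqxx.
  - apply/forall_inP=> v vu; apply/cards1P; exists (f v).
    by apply/setP=> y; rewrite !inE mem_map_edges vu eq_sym.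
case/and4P=> /subsetP SE /and3P[/'forall_'forall_idP conn _ _] Su /forall_inP S1.
(* The default value makes [u], which has no outgoing edge, a fixed point. *)
pose f := [ffun v => odflt u [pick y | (v, y) \in S]].
have {}Su y : (u, y) \in S = false.
  by move: Su; rewrite cards_eq0 => /eqP/setP/(_ y); rewrite !inE.
have fu : f u = u by rewrite ffunE; case: pickP => //= y; rewrite Su.
have Sf x y : ((x, y) \in S) = (x != u) && (f x == y).
  have [->|xu] := eqVneq x u; first exact: Su.
  have /cards1P[z /setP Sz] := S1 x xu.
  have {}Sz t : ((x, t) \in S) = (t == z) by have := Sz t; rewrite !inE.
  rewrite ffunE Sz; case: pickP => [t|/(_ z)]; rewrite Sz ?eqxx // => /eqP->.
  by rewrite eq_sym.
exists f; last by apply/setP=> -[x y]; rewrite Sf mem_map_edges.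
rewrite inE; apply/andP; split; last first.
  apply/forall_inP=> v vu; have := SE (v, f v); rewrite Sf vu eqxx inE.
  exact.
rewrite /rooted_map fu eqxx; apply/forallP=> v.
have step x y : (x, y) \in S -> fconnect f x u = fconnect f y u.
  by rewrite Sf => /andP[xu /eqP <-]; exact: fconnect_step.
(* An edge is one step of [f], so either both its ends reach [u] or neither does. *)
have cl : closed (underlying S) [pred x | fconnect f x u].
  by move=> x y /orP[] /step; rewrite !inE => ->.
by have := closed_connect cl (conn u v); rewrite !inE connect0 => <-.
Qed.

Variable F : fieldType.

(** Puts the tree sum in the form given by expanding a determinant over maps. *)
Lemma tree_sum_rooted_map E (w : V -> V -> F) :
  tree_sum E w u =
    \sum_(f | rooted_map f && [forall (v | v != u), E v (f v)])
      \prod_(v | v != u) w v (f v).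
Proof.
rewrite /tree_sum oriented_spanning_treesE big_imset /=; last first.
  by move=> f g; rewrite !inE => /andP[rf _] /andP[rg _]; apply: map_edges_inj.
under eq_bigl do rewrite inE; apply: eq_bigr => f _.
by rewrite big_imset //= => x y _ _ [].
Qed.

End SpanningTrees.

(** * Matrices indexed by finite types *)

Definition finmx (F : Type) (I J : finType) (g : I -> J -> F) : 'M_(#|I|, #|J|) :=
  \matrix_(i, j) g (enum_val i) (enum_val j).

Lemma big_enum_valT (R : Type) (idx : R) (op : Monoid.com_law idx) (I : finType)
    (g : I -> R) :
  \big[op/idx]_x g x = \big[op/idx]_(i < #|I|) g (enum_val i).
Proof.
by rewrite (reindex (@enum_val I I)) //; apply: onW_bij; exact: enum_val_bij.
Qed.

Section FinMatrix.
Variable F : fieldType.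

Lemma eq_finmx (I J : finType) (g h : I -> J -> F) : g =2 h -> finmx g = finmx h.
Proof. by move=> gh; apply/matrixP=> i j; rewrite !mxE gh. Qed.

Lemma finmxE (I J : finType) (g : I -> J -> F) x y :
  finmx g (enum_rank x) (enum_rank y) = g x y.
Proof. by rewrite mxE !enum_rankK. Qed.

Lemma mul_finmx (I J K : finType) (g : I -> J -> F) (h : J -> K -> F) :
  finmx g *m finmx h = finmx (fun x z => \sum_y g x y * h y z).
Proof.
apply/matrixP=> i k; rewrite !mxE [RHS]big_enum_valT.
by apply: eq_bigr => j _; rewrite !mxE.
Qed.

Lemma finmxB (I J : finType) (g h : I -> J -> F) :
  finmx g - finmx h = finmx (fun x y => g x y - h x y).
Proof. by apply/matrixP=> i j; rewrite !mxE. Qed.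

Lemma finmx1 (I : finType) : 1%:M = finmx (fun x y : I => (x == y)%:R : F).
Proof. by apply/matrixP=> i j; rewrite !mxE (inj_eq enum_val_inj). Qed.

Lemma det_finmx_diag (I : finType) (d : I -> F) :
  \det (finmx (fun x y => d x *+ (x == y))) = \prod_x d x.
Proof.
rewrite (_ : finmx _ = diag_mx (\row_i d (enum_val i))).
  by rewrite det_diag [RHS]big_enum_valT; apply: eq_bigr => i _; rewrite mxE.
by apply/matrixP=> i j; rewrite !mxE (inj_eq enum_val_inj).
Qed.

Lemma mul_diag_finmx (I J : finType) (d : I -> F) (g : I -> J -> F) :
  finmx (fun x y => d x *+ (x == y)) *m finmx g = finmx (fun x z => d x * g x z).
Proof.
rewrite mul_finmx; apply: eq_finmx => x z.
rewrite (bigD1 x) //= eqxx big1 ?addr0 // => y.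
by rewrite eq_sym => /negPf->; rewrite mul0r.
Qed.

Lemma mul_finmx_diag (I J : finType) (g : I -> J -> F) (d : J -> F) :
  finmx g *m finmx (fun x y => d x *+ (x == y)) = finmx (fun x z => g x z * d z).
Proof.
rewrite mul_finmx; apply: eq_finmx => x z.
rewrite (bigD1 z) //= eqxx big1 ?addr0 // => y /negPf->.
by rewrite mulr0.
Qed.

(** Multilinearity in the rows: [f] selects the summand [f x] of row [x]. *)
Lemma det_finmx_multilinear (I J : finType) (c : I -> J -> F) (N : I -> J -> I -> F) :
  \det (finmx (fun x z => \sum_y c x y * N x y z)) =
    \sum_(f : {ffun I -> J})
      (\prod_x c x (f x)) * \det (finmx (fun x z => N x (f x) z)).
Proof.
under [RHS]eq_bigr do rewrite big_distrr /=.
rewrite exchange_big; apply: eq_bigr => s _ /=.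
under [RHS]eq_bigr do rewrite mulrCA.
rewrite -big_distrr /=; congr (_ * _).
pose t x := enum_val (s (enum_rank x)).
transitivity (\prod_x \sum_y c x y * N x y (t x)).
  by rewrite [RHS]big_enum_valT; apply: eq_bigr => i _; rewrite mxE /t enum_valK.
rewrite bigA_distr_bigA; apply: eq_bigr => f _; rewrite big_split; congr (_ * _).
by rewrite [LHS]big_enum_valT; apply: eq_bigr => i _; rewrite mxE /t enum_valK.
Qed.

Lemma det_kernel_eq0 n (A : 'M[F]_n) (v : 'cV[F]_n) :
  v != 0 -> A *m v = 0 -> \det A = 0.
Proof.
move=> v0 Av; apply/eqP; rewrite -det_tr; apply/det0P; exists v^T.
  by rewrite trmx_eq0.
by rewrite -trmx_mul Av trmx0.
Qed.

(** The cofactors along row [i] do not see that row, so their linear combinations are again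
    determinants. *)
Lemma det_row_replace n (A : 'M[F]_n) i (r : 'I_n -> F) :
  \det (\matrix_(k, l) if k == i then r l else A k l) =
    \sum_j r j * cofactor A i j.
Proof.
rewrite (expand_det_row _ i); apply: eq_bigr => j _; rewrite mxE eqxx.
congr (_ * (_ * \det _)); apply/matrixP=> k l; rewrite !mxE.
by rewrite eq_sym (negPf (neq_lift _ _)).
Qed.

End FinMatrix.

(** * The matrix tree theorem *)

Section MatrixTree.
Variables (F : fieldType) (V : finType) (E : rel V) (w : V -> V -> F).

Definition laplacian x y : F := wdegree E w x *+ (x == y) - w x y *+ E x y.

(* The Laplacian of the functional digraph of [f], its row [u] being replaced by
   that of the identity matrix. *)
Definition map_laplacian (u : V) (f : V -> V) x y : F :=
  (x == y)%:R - ((x != u) && (f x == y))%:R.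

(* Only the identity permutation contributes to the Leibniz formula: another one
   would move, with any vertex, its image under [f], hence the root [u], which it
   has to fix. *)
Lemma det_map_laplacian_rooted u (f : {ffun V -> V}) :
  rooted_map u f -> \det (finmx (map_laplacian u f)) = 1.
Proof.
move=> rf; have /andP[_ /forallP reach] := rf.
rewrite /determinant (bigD1 (1%g : 'S_#|V|)) //= odd_perm1 mul1r.
rewrite big1 => [|i _]; last first.
  rewrite mxE perm1 /map_laplacian eqxx; case: eqP => /= [_|/eqP iu].
    by rewrite subr0.
  by rewrite (negPf (rooted_map_neq rf iu)) subr0.
rewrite big1 ?addr0 // => s; apply: contraNeq.
rewrite mulf_eq0 negb_or => /andP[_ /prodf_neq0 s_nz].
pose t x := enum_val (s (enum_rank x)).
have tP x : t x = x \/ x != u /\ f x = t x.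
  have := s_nz (enum_rank x) isT; rewrite mxE /map_laplacian enum_rankK -/(t x).
  case: (x =P t x) => [xt _|_]; first by left.
  case: andP => [[xu /eqP fx] _|_]; first by right.
  by rewrite subrr eqxx.
have t_inj : injective t.
  by move=> x y /enum_val_inj/perm_inj/enum_rank_inj.
have step k x : t x != x -> t (iter k f x) != iter k f x.
  move=> tx; elim: k => //= k IHk; move: IHk; case: (tP (iter k f x)).
    by move=> ->; rewrite eqxx.
  by case=> _ ->; apply: contraNneq => /t_inj ->.
apply/eqP/permP=> i; rewrite perm1; apply/eqP.
have: t (enum_val i) == enum_val i.
  apply: contraT => /(step (findex f (enum_val i) u)).
  by rewrite iter_findex ?reach //; case: (tP u) => [->|[+ _]]; rewrite eqxx.
by rewrite /t enum_valK (inj_eq enum_val_inj).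
Qed.

(* The indicator of the vertices that do not reach [u] is in the kernel. *)
Lemma det_map_laplacian_unrooted u (f : {ffun V -> V}) :
  f u = u -> ~~ rooted_map u f -> \det (finmx (map_laplacian u f)) = 0.
Proof.
move=> fu; rewrite /rooted_map fu eqxx => /forallPn[x xu].
pose C v := (~~ fconnect f v u)%:R : F.
apply: (@det_kernel_eq0 _ _ _ (\col_i C (enum_val i))).
  apply/eqP=> /colP/(_ (enum_rank x)); rewrite !mxE enum_rankK /C xu.
  by apply/eqP; exact: oner_neq0.
apply/colP=> i; rewrite !mxE; pose v := enum_val i.
transitivity (\sum_y map_laplacian u f v y * C y).
  by rewrite [RHS]big_enum_valT; apply: eq_bigr => j _; rewrite !mxE.
move: v => v; clear i.
rewrite /map_laplacian; under eq_bigr do rewrite mulrBl.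
rewrite sumrB (bigD1 v) //= eqxx mul1r big1 => [|y]; last first.
  by rewrite eq_sym => /negPf->; rewrite mul0r.
rewrite addr0 (bigD1 (f v)) //= eqxx andbT big1 => [|y]; last first.
  by rewrite eq_sym => /negPf->; rewrite andbF mul0r.
rewrite addr0; have [->|vu] := eqVneq v u; rewrite ?mul1r.
  by rewrite mul0r subr0 /C connect0.
by rewrite /C (fconnect_step f vu) subrr.
Qed.

(** Off the root, row [x] is the sum over [y] of [w x y] times the difference of the unit vectors at
    [x] and [y], over the edges. Expanding by rows gives one map Laplacian per map [f], of
    determinant 1 or 0 according to whether [f] is rooted. *)
Lemma det_laplacian_row_delta u :
  \det (finmx (fun x y => if x == u then (y == u)%:R else laplacian x y)) =
    tree_sum E w u.
Proof.
(* In row [u] the coefficient keeps only the maps that fix [u]. *)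
pose c x y : F := if x == u then (y == u)%:R else w x y *+ E x y.
(* Row [x] of a map Laplacian depends only on the image of [x], so a constant map can stand for [f]
   there. *)
pose N x y z : F := map_laplacian u (fun=> y) x z.
rewrite (_ : finmx _ = finmx (fun x z => \sum_y c x y * N x y z)); last first.
  apply: eq_finmx => x z; rewrite /c /N /map_laplacian.
  have [->|xu] := eqVneq x u.
    rewrite (bigD1 u) //= eqxx mul1r subr0 eq_sym.
    by rewrite big1 ?addr0 // => y /negPf->; rewrite mul0r.
  under eq_bigr do rewrite mulrBr; rewrite sumrB -mulr_suml mulr_natr.
  rewrite /laplacian /wdegree [in LHS]big_mkcond /=; congr (_ *+ _ - _).
    by apply: eq_bigr => y _; case: (E x y).
  rewrite (bigD1 z) //= eqxx mulr1.
  by rewrite big1 ?addr0 // => y /negPf->; rewrite mulr0.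
rewrite det_finmx_multilinear tree_sum_rooted_map [RHS]big_mkcond.
apply: eq_bigr => f _; rewrite /N -/(map_laplacian u f).
rewrite (bigD1 u) //= {1}/c eqxx.
have [fu|fu] := eqVneq (f u) u; last by rewrite /rooted_map (negPf fu) !mul0r.
rewrite mul1r; case: ifP => [/andP[rf /forall_inP Ef]|].
  rewrite det_map_laplacian_rooted // mulr1; apply: eq_bigr => x xu.
  by rewrite /c (negPf xu) Ef.
case: (boolP (rooted_map u f)) => [_ /= /negbT|nr _]; last first.
  by rewrite det_map_laplacian_unrooted ?mulr0.
case/forall_inPn => x xu /negPf Ex.
by rewrite (bigD1 x) //= /c (negPf xu) Ex !mul0r.
Qed.

Lemma laplacian_row_sum x : \sum_y laplacian x y = 0.
Proof.
rewrite sumrB (bigD1 x) //= eqxx big1 => [|y]; last first.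
  by rewrite eq_sym => /negPf->.
rewrite addr0 /wdegree [in X in X - _]big_mkcond; apply/eqP; rewrite subr_eq0.
by apply/eqP/eq_bigr => y _; case: (E x y).
Qed.

(** Two cofactors in row [j] differ by the determinant with that row replaced by a difference of
    unit vectors; all rows then sum to zero, so it vanishes. The diagonal cofactor is the
    determinant with row [j] replaced by a unit vector. *)
Lemma adj_laplacian : \adj (finmx laplacian) = finmx (fun _ u => tree_sum E w u).
Proof.
apply/matrixP=> i j; rewrite !mxE; set A := finmx laplacian.
have -> : cofactor A j i = cofactor A j j.
  apply/eqP; rewrite -subr_eq0; apply/eqP.
  pose r l : F := (l == i)%:R - (l == j)%:R.
  transitivity (\sum_l r l * cofactor A j l).
    rewrite /r; under [RHS]eq_bigr do rewrite mulrBl.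
    rewrite sumrB (bigD1 i) //= eqxx mul1r big1 => [|l /negPf->]; last exact: mul0r.
    rewrite (bigD1 j) //= eqxx mul1r big1 => [|l /negPf->]; last exact: mul0r.
    by rewrite !addr0.
  rewrite -det_row_replace; apply: (@det_kernel_eq0 _ _ _ (const_mx 1)).
    by apply/eqP=> /colP/(_ i); rewrite !mxE; apply/eqP; exact: oner_neq0.
  apply/colP=> k; rewrite !mxE; under eq_bigr do rewrite !mxE mulr1.
  case: eqP => _.
    rewrite sumrB (bigD1 i) //= eqxx big1 => [|l /negPf->] //.
    by rewrite (bigD1 j) //= eqxx big1 => [|l /negPf->] //; rewrite !addr0 subrr.
  rewrite -[RHS](laplacian_row_sum (enum_val k)) [RHS]big_enum_valT.
  exact: eq_bigr.
rewrite -det_laplacian_row_delta.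
transitivity (\sum_l (l == j)%:R * cofactor A j l).
  rewrite (bigD1 j) //= eqxx mul1r big1 => [|l /negPf->]; last exact: mul0r.
  by rewrite addr0.
rewrite -det_row_replace; congr (\det _); apply/matrixP=> k l.
by rewrite !mxE !(inj_eq enum_val_inj).
Qed.

End MatrixTree.

(** * Comparing the adjugates of the two factored Laplacians *)

Section AdjugateFactor.
Variables (R : idomainType) (m n : nat).
Variables (D : 'M[R]_m) (W : 'M[R]_n) (X : 'M[R]_(m, n)) (Y : 'M[R]_(n, m)).

Lemma adj_mull : \adj (D *m (1%:M - X *m Y)) *m D = \det D *: \adj (1%:M - X *m Y).
Proof. by rewrite adj_mulmx -mulmxA mul_adj_mx mul_mx_scalar. Qed.

Lemma adj_mulr : W *m \adj ((1%:M - Y *m X) *m W) = \det W *: \adj (1%:M - Y *m X).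
Proof. by rewrite adj_mulmx mulmxA mul_mx_adj mul_scalar_mx. Qed.

(** The factors [D] and [W] reduce both sides to adjugates of [1 - X Y] and [1 - Y X], which
    [adj_mulmxC] relates. This version leads to identity (2), the next one to (1). *)
Lemma adj_swap_right :
  \det W *: (\adj (D *m (1%:M - X *m Y)) *m (D *m X)) =
    \det D *: (X *m W *m \adj ((1%:M - Y *m X) *m W)).
Proof.
rewrite mulmxA adj_mull -[X *m W *m _]mulmxA adj_mulr -scalemxAl -scalemxAr.
by rewrite adj_mulmxC !scalerA mulrC.
Qed.

Lemma adj_swap_left :
  \det W *: (Y *m \adj (D *m (1%:M - X *m Y)) *m D) =
    \det D *: (W *m \adj ((1%:M - Y *m X) *m W) *m Y).
Proof.
rewrite -mulmxA adj_mull adj_mulr -scalemxAl -scalemxAr.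
by rewrite adj_mulmxC !scalerA mulrC.
Qed.

End AdjugateFactor.

(** * Laplacians of a digraph and of its biclique digraph *)

Section BicliquePartition.
Variables (F : fieldType) (V : finType) (E : rel V).
Variables (eps : {set {set V} * {set V}}) (w : V -> F).
Hypothesis eps_part : biclique_partition E eps.

Local Notation O := (Omega_vertex eps).
Local Notation wG := (induced_weight w).
Local Notation wO := (@Omega_weight V F E w eps).
Local Notation d := (wdegree E wG).
Local Notation b Q := (biclique_weight w (val Q)).

(** An edge lies in exactly one biclique and a non-edge in none: this factors the adjacency matrix
    through [eps]. *)
Lemma biclique_partition_sum x y :
  \sum_(Q : O) ((x \in (val Q).1) && (y \in (val Q).2))%:R = (E x y)%:R :> F.
Proof.
case: eps_part => bic cov; have [Exy|nExy] := boolP (E x y); last first.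
  rewrite big1 // => Q _; have [_ /subsetP/(_ (x, y))] := bic _ (valP Q).
  by rewrite in_setX inE /= (negPf nExy); case: (_ && _) => // /(_ isT).
have [|Q0 [[Q0e Q0xy] uQ0]] := cov (x, y); first by rewrite inE.
rewrite (bigD1 (exist _ Q0 Q0e : O)) //= -in_setX Q0xy big1 ?addr0 // => Q.
move=> QQ0; case: andP => // -[xQ yQ]; case/eqP: QQ0; apply: val_inj => /=.
by apply/esym/uQ0; split; [exact: valP | rewrite in_setX xQ].
Qed.

(** Each biclique with [x] among its tails contributes edges from [x] to all its heads, of total
    weight [b Q]. *)
Lemma wdegree_bicliques x : d x = \sum_(Q : O | x \in (val Q).1) b Q.
Proof.
rewrite /wdegree big_mkcond [RHS]big_mkcond /=.
under [RHS]eq_bigr => Q _.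
  rewrite (_ : (if _ then _ else _) =
    \sum_y w y * ((x \in (val Q).1) && (y \in (val Q).2))%:R); last first.
    case: ifP => _; rewrite /biclique_weight ?[LHS]big_mkcond /=.
      by apply: eq_bigr => y _; case: ifP; rewrite ?mulr1 ?mulr0.
    by rewrite big1 // => y _; rewrite mulr0.
  over.
rewrite exchange_big; apply: eq_bigr => y _ /=.
rewrite -mulr_sumr biclique_partition_sum /induced_weight.
by case: (E x y); rewrite ?mulr1 ?mulr0.
Qed.

Hypothesis d_neq0 : forall x, d x != 0.

(** The matrices [X], [Y], [D] and [W] of the factorisations, in this order. *)
Definition tail_mx := finmx (fun x (Q : O) => (x \in (val Q).1)%:R / d x).
Definition head_mx := finmx (fun (Q : O) x => w x * (x \in (val Q).2)%:R).
Definition degree_mx := finmx (fun x y => d x *+ (x == y)).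
Definition biclique_mx := finmx (fun P Q : O => b P *+ (P == Q)).

Lemma laplacian_factor :
  finmx (laplacian E wG) = degree_mx *m (1%:M - tail_mx *m head_mx).
Proof.
rewrite mul_finmx finmx1 finmxB mul_diag_finmx; apply: eq_finmx => x y.
rewrite mulrBr mulr_natr; congr (_ - _).
rewrite mulr_sumr -mulr_natr -biclique_partition_sum mulr_sumr.
apply: eq_bigr => Q _; rewrite -mulnb natrM /induced_weight.
by rewrite !mulrA [d x * _]mulrC mulfK // [_ * w y]mulrC.
Qed.

Lemma Omega_weight_edge P Q : wO P Q *+ Omega_edge P Q = wO P Q.
Proof.
rewrite /Omega_edge; case: eqP => //= PQ.
by rewrite /Omega_weight PQ big_set0 mulr0.
Qed.

(** After exchanging sums, the weights [b Q] of the bicliques with tail [u] add up to [d u], which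
    cancels the denominator. *)
Lemma wdegree_Omega P : wdegree (@Omega_edge V eps) wO P = b P.
Proof.
rewrite /wdegree big_mkcond /=.
transitivity (\sum_(Q : O) \sum_(u in (val P).2)
   (w u / d u) * (if u \in (val Q).1 then b Q else 0)).
  apply: eq_bigr => Q _; rewrite -mulrb Omega_weight_edge /Omega_weight.
  rewrite mulr_sumr big_mkcond [RHS]big_mkcond /=; apply: eq_bigr => u _.
  rewrite inE; case: (u \in _) => //=; case: (u \in _); rewrite ?mulr0 //.
  by rewrite mulrC.
rewrite exchange_big; apply: eq_bigr => u _ /=.
by rewrite -mulr_sumr -big_mkcond /= -wdegree_bicliques divfK.
Qed.

Lemma Omega_laplacian_factor :
  finmx (laplacian (@Omega_edge V eps) wO) =
    (1%:M - head_mx *m tail_mx) *m biclique_mx.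
Proof.
rewrite mul_finmx finmx1 finmxB mul_finmx_diag; apply: eq_finmx => P Q.
rewrite /laplacian wdegree_Omega mulrBl Omega_weight_edge; congr (_ - _).
  by case: eqP => [->|_]; rewrite ?mul1r ?mul0r.
rewrite mulrC /Omega_weight big_mkcond /=; congr (_ * _).
apply: eq_bigr => u _; rewrite inE.
by do 2!case: (u \in _); rewrite /= !(mulr1, mul1r, mul0r, mulr0).
Qed.

Lemma degree_tail_mx :
  degree_mx *m tail_mx = finmx (fun x (Q : O) => (x \in (val Q).1)%:R).
Proof.
by rewrite mul_diag_finmx; apply: eq_finmx => x Q; rewrite mulrC divfK.
Qed.

(** The rows of [X W] sum to 1; as the adjugate of the Laplacian of [Omega(eps)] has equal rows,
    multiplying it by [X W] reproduces its entries. *)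
Lemma tail_biclique_row_sum x :
  \sum_(Q : O) (x \in (val Q).1)%:R / d x * b Q = 1.
Proof.
rewrite -[RHS](mulfV (d_neq0 x)) [in RHS]mulrC [X in _ = _ * X]wdegree_bicliques.
rewrite mulr_sumr [RHS]big_mkcond; apply: eq_bigr => Q _ /=.
by case: (x \in _); rewrite ?mul1r ?mul0r.
Qed.

(** Entry [(x, Q)] of [adj_swap_right]; [x] names the row that is read. *)
Lemma tree_sum_tails (x : V) (Q : O) :
  \prod_(P in eps) biclique_weight w P * \sum_(u in (val Q).1) tree_sum E wG u =
    \prod_v d v * tree_sum (@Omega_edge V eps) wO Q.
Proof.
have := adj_swap_right degree_mx biclique_mx tail_mx head_mx.
rewrite -laplacian_factor -Omega_laplacian_factor !adj_laplacian.
rewrite degree_tail_mx mul_finmx_diag !mul_finmx.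
move/matrixP/(_ (enum_rank x) (enum_rank Q)).
rewrite mxE finmxE [RHS]mxE finmxE !det_finmx_diag -big_sub.
rewrite -mulr_suml tail_biclique_row_sum mul1r => <-; congr (_ * _).
by rewrite big_mkcond; apply: eq_bigr => u _; rewrite mulr_natr mulrb.
Qed.

(** Entry [(Q, u)] of [adj_swap_left]; the row index [Q] leaves a factor [b Q] on both sides. *)
Lemma tree_sum_heads (Q : O) u :
  \prod_(P in eps) biclique_weight w P * (b Q * tree_sum E wG u * d u) =
    \prod_v d v * (b Q * (w u *
     \sum_(P : O | u \in (val P).2) tree_sum (@Omega_edge V eps) wO P)).
Proof.
have head_row_sum : \sum_x w x * (x \in (val Q).2)%:R = b Q.
  rewrite /biclique_weight [RHS]big_mkcond.
  by apply: eq_bigr => y _; rewrite mulr_natr mulrb.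
have := adj_swap_left degree_mx biclique_mx tail_mx head_mx.
rewrite -laplacian_factor -Omega_laplacian_factor !adj_laplacian.
rewrite mul_diag_finmx [head_mx *m _]mul_finmx mul_finmx_diag mul_finmx.
move/matrixP/(_ (enum_rank Q) (enum_rank u)).
rewrite mxE finmxE [RHS]mxE finmxE !det_finmx_diag -big_sub.
rewrite -mulr_suml head_row_sum => ->; congr (_ * _).
rewrite [in RHS]big_mkcond !mulr_sumr; apply: eq_bigr => P _ /=.
rewrite -mulrA; congr (_ * _); rewrite mulrCA; congr (_ * _).
by rewrite mulr_natr mulrb.
Qed.

Hypothesis b_neq0 : forall Q, Q \in eps -> biclique_weight w Q != 0.

Lemma prod_biclique_weight_neq0 : \prod_(P in eps) biclique_weight w P != 0.
Proof. exact/prodf_neq0. Qed.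

Lemma tree_sum_from_Omega u : (0 < outdegree E u)%N ->
  tree_sum E wG u =
    w u * (\prod_(v | v != u) d v) / (\prod_(P in eps) biclique_weight w P) *
    \sum_(P : O | u \in (val P).2) tree_sum (@Omega_edge V eps) wO P.
Proof.
(* An edge out of [u] provides a biclique to serve as row index. *)
case/card_gt0P=> v; rewrite inE => Euv.
have [|Q [[Qe _] _]] := eps_part.2 (u, v); first by rewrite inE.
have := tree_sum_heads (exist _ Q Qe) u; rewrite (bigD1 u) //=.
have := prod_biclique_weight_neq0; have := d_neq0 u; have := b_neq0 Qe.
set W := \prod_(P in eps) _; set p := \prod_(v | _) _; set t := tree_sum E wG u.
set S := \sum_(P | _) _; move: (biclique_weight w Q) (d u) (w u) W p t S.
move=> bQ du wu W p t S bQ0 du0 W0 eqQ.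
apply: (mulfI (mulf_neq0 W0 (mulf_neq0 bQ0 du0))).
transitivity (W * (bQ * t * du)); first by ring.
by rewrite eqQ; field.
Qed.

Lemma Omega_tree_sum (Q : O) :
  tree_sum (@Omega_edge V eps) wO Q =
    (\prod_(P in eps) biclique_weight w P) / (\prod_v d v) *
    \sum_(u in (val Q).1) tree_sum E wG u.
Proof.
(* A tail of [Q] serves as row index. *)
have [/and3P[/set0Pn[x _] _ _] _] := eps_part.1 _ (valP Q).
have D_neq0 : \prod_v d v != 0 by apply/prodf_neq0 => v _; exact: d_neq0.
by rewrite mulrAC (tree_sum_tails x Q) mulrAC mulfV ?mul1r.
Qed.

End BicliquePartition.

(** * Nonvanishing denominators and conclusion *)

(** The indeterminate of any [v] in [A] has coefficient 1 in the sum. *)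
Lemma indet_sum_neq0 (R : idomainType) (V : finType) (A : {set V}) :
  A != set0 -> \sum_(v in A) indet R v != 0.
Proof.
case/set0Pn=> v vA; rewrite -rmorph_sum /= tofrac_eq0.
apply/eqP=> /(congr1 (mcoeff U_(enum_rank v)%MM)); rewrite mcoeff0 raddf_sum /=.
rewrite (bigD1 v) //= mcoeffX eqxx big1 => [/eqP|u /andP[_ uv]].
  by rewrite addr0 oner_eq0.
by rewrite mcoeffX eq_mnm1 (inj_eq enum_rank_inj) (negPf uv).
Qed.

Theorem theorem3p1 (R : idomainType) (V : finType) (E : rel V)
    (eps : {set {set V} * {set V}})
    (outdeg_gt0 : forall u : V, (0 < outdegree E u)%N)
    (eps_part : biclique_partition E eps) :
  let w : V -> ratfun R V := @indet R V in
  let wG := induced_weight w in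
  let wO := @Omega_weight V (ratfun R V) E w eps in
  (forall u : V,
     tree_sum E wG u =
       w u * (\prod_(v | v != u) wdegree E wG v) /
       (\prod_(Q in eps) biclique_weight w Q) *
       \sum_(Q : Omega_vertex eps | u \in (val Q).2)
          tree_sum (@Omega_edge V eps) wO Q) /\
  (forall Q : Omega_vertex eps,
     tree_sum (@Omega_edge V eps) wO Q =
       (\prod_(P in eps) biclique_weight w P) /
       (\prod_(v : V) wdegree E wG v) *
       \sum_(u in (val Q).1) tree_sum E wG u).
Proof.
move=> w wG wO.
have d_neq0 u : wdegree E wG u != 0.
  (* The degree of [u] is the sum of the indeterminates over its set of out-neighbours, nonempty by
     the outdegree hypothesis. *)
  rewrite /wdegree; under eq_bigl do rewrite -[E u _](in_set (E u)).
  by apply: indet_sum_neq0; rewrite -card_gt0; exact: outdeg_gt0.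
have b_neq0 Q : Q \in eps -> biclique_weight w Q != 0.
  by case/(eps_part.1)=> /and3P[_ Q2 _] _; exact: indet_sum_neq0.
split=> [u|Q].
  exact: (tree_sum_from_Omega eps_part d_neq0 b_neq0 (outdeg_gt0 u)).
exact: (Omega_tree_sum eps_part d_neq0 Q).
Qed.
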